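(* Let $w\in S_\infty$, $k\leq l$, and let $\eta$ be a multi-set. If $m^{k,l}_\eta(w)\neq0$, then $\eta\in B_{k,l}(w)$.
   Context: Permutations in $S_\infty$ compose as functions, $s_i$ is the transposition of $i,i+1$, $\ell(w)$ is the length. For $l\geq1$, $w^l$ is the increasing ordering of $w(1),\dots,w(l)$; $A_l(w)$ is the set of strictly increasing sequences $\alpha$ of $l$ positive integers with $\alpha_j\leq w^l_j$ for all $j$ (identified with sets); $s_i\alpha$ is the increasing sequence with entry set $\{s_i(\alpha_j)\}$; $A_{l,i}(w)=\{\alpha\in A_l(w):s_i\alpha\notin A_l(w)\}$. $x^\alpha=\prod_jx_{\alpha_j}$; for a multi-set $\eta$, $x^\eta=\prod_jx_j^{\mathrm{mult}_\eta(j)}$. $T_l=t_1\cdots t_l$. $\pi_if=(x_if-x_{i+1}s_if)/(x_i-x_{i+1})$ with $s_i$ swapping $x_i,x_{i+1}$. For $\ell(s_iw)>\ell(w)$, $N_{w,i}=\prod_{l\geq1}\prod_{\alpha\in A_{l,i}(w)}(1-x^{s_i\alpha}T_l)$; $P_{\mathrm{Id}}=1$ and $P_{s_iw}=\pi_i(P_wN_{w,i})$ whenever $\ell(s_iw)>\ell(w)$ (well defined). Viewing $P_w$ as a polynomial in $x$ and the algebraically independent $T_l$'s, $m^{k,l}_\eta(w)$ (for $k\leq l$) is minus the coefficient of $x^\eta T_kT_l$ in $P_w$. For sets $\alpha,\beta$, $\alpha+\beta$ is the multi-set union. $B_{k,l}(w)$ is the set of multi-sets $\eta$ for which there exist $\alpha,\tilde\alpha\in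 A_l(w)$ and $\beta,\tilde\beta\in A_k(w)$ with $\eta=\alpha+\beta=\tilde\alpha+\tilde\beta$ and $\alpha\neq\tilde\alpha$, $\alpha\neq\tilde\beta$, $\beta\neq\tilde\alpha$, $\beta\neq\tilde\beta$. *)

(* Defs.v *)
From mathcomp Require Import all_boot all_order all_algebra.
From mathcomp Require Import finmap multiset.
From mathcomp Require Import monalg zify ring.
From mathcomp Require Import boolp classical_sets functions cardinality fsbigop.

Set Implicit Arguments.
Unset Strict Implicit.
Unset Printing Implicit Defensive.

Import GRing.Theory.

Local Open Scope ring_scope.

(* Elements of S_oo are functions on nat that fix 0, so that it is the positive
   integers that are permuted. *)
Definition Sinf (w : nat -> nat) : Prop :=
  [/\ bijective w, w 0 = 0 & finite_set [set j | w j <> j]]%N.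

Definition s_ (i j : nat) : nat :=
  if j == i then i.+1 else if j == i.+1 then i else j.

(* The number of inversions; 0 belongs to no inversion of an element of S_oo. *)
Definition len (w : nat -> nat) : nat :=
  #|` fset_set [set p : nat * nat | (p.1 < p.2)%N /\ (w p.2 < w p.1)%N] |.

Definition wsort (w : nat -> nat) (l : nat) : seq nat :=
  sort leq [seq w j | j <- iota 1 l].

Definition A_ (l : nat) (w : nat -> nat) : set (seq nat) :=
  [set a | [/\ size a = l, sorted ltn a, all (leq 1) a &
    forall j, (j < l)%N -> (nth 0 a j <= nth 0 (wsort w l) j)%N]].

Definition s_act (i : nat) (a : seq nat) : seq nat := sort leq (map (s_ i) a).

Definition Ai_ (l i : nat) (w : nat -> nat) : set (seq nat) :=
  [set a | A_ l w a /\ ~ A_ l w (s_act i a)].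

(* Polynomials over the integers in the variables x_j (indexed by inl j) and
   T_l (indexed by inr l); since the products T_l = t_1 ... t_l are
   algebraically independent, they are taken as variables. *)
Definition mon := {cmonom (nat + nat)%type}.
Definition pol := {malg int[mon]}.

Definition xmon (a : seq nat) : mon := \big[mmul/mone]_(j <- a) ucm (inl j).
Definition Tmon (l : nat) : mon := ucm (inr l).

Definition xvar (j : nat) : pol := << ucm (inl j) >>.
Definition xpow (a : seq nat) : pol := << xmon a >>.
Definition Tvar (l : nat) : pol := << Tmon l >>.

Definition s_var (i : nat) (v : nat + nat) : nat + nat :=
  match v with inl j => inl (s_ i j) | inr l => inr l end.

Definition s_mon (i : nat) (m : mon) : mon :=
  \big[mmul/mone]_(v <- finsupp m) expcmn (ucm (s_var i v)) (m v).

Definition s_pol (i : nat) (f : pol) : pol :=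
  mmap (@malgC mon int) (fun m => << s_mon i m >>) f.

(* [xget 0] selects the quotient, which exists by [pi_E] and is unique by
   [xvarB_reg]. *)
Definition pi_ (i : nat) (f : pol) : pol :=
  xget 0 [set q | (xvar i - xvar i.+1) * q =
                  xvar i * f - xvar i.+1 * s_pol i f]%classic.

(* Both products have finite support for w in S_oo: A_l(w) is finite, and
   A_{l,i}(w) is empty as soon as l > i and w fixes every j > l. *)
Definition N_ (w : nat -> nat) (i : nat) : pol :=
  \big[*%R/1]_(l \in [set l | (1 <= l)%N])
    \big[*%R/1]_(a \in Ai_ l i w) (1 - xpow (s_act i a) * Tvar l).

(* [isP w p]: the recursion, along some chain of length-increasing left
   multiplications from the identity to w, gives the value p for P_w. *)
Inductive isP : (nat -> nat) -> pol -> Prop :=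
| isP_id : isP id 1
| isP_step w i p : (1 <= i)%N -> isP w p -> (len w < len (s_ i \o w))%N ->
    isP (s_ i \o w) (pi_ i (p * N_ w i)).

(* eta is coerced to the sequence of its elements, with multiplicities. *)
Definition mcoef (p : pol) (k l : nat) (eta : {mset nat}%mset) : int :=
  - p@_(mmul (xmon eta) (mmul (Tmon k) (Tmon l))).

Definition B_ (k l : nat) (w : nat -> nat) : set {mset nat}%mset :=
  [set eta | exists a a' b b' : seq nat,
    [/\ A_ l w a, A_ l w a', A_ k w b & A_ k w b'] /\
    [/\ eta = seq_mset (a ++ b), eta = seq_mset (a' ++ b') &
     [/\ a <> a', a <> b', b <> a' & b <> b']]].

(* Well-definedness of [pi_]. *)

Lemma cm_prod (J : Type) (r : seq J) (F : J -> mon) u :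
  (\big[mmul/mone]_(v <- r) F v) u = (\sum_(v <- r) F v u)%N.
Proof.
elim: r => [|v r IH]; first by rewrite !big_nil cm1.
by rewrite !big_cons cmM IH.
Qed.

Lemma cm_exp (m : mon) n u : expcmn m n u = (n * m u)%N.
Proof.
rewrite /expcmn; case: n => [|n]; first by rewrite /= cm1.
rewrite iteropS; elim: n => [|n IH] /=; first by rewrite mul1n.
by rewrite mulcmE IH mulSn.
Qed.

Lemma s_K i : involutive (s_ i).
Proof. by rewrite /s_ => j; repeat case: eqP => //; lia. Qed.

Lemma s_varK i : involutive (s_var i).
Proof. by case=> j //=; rewrite s_K. Qed.

Lemma cm_subst (g : nat + nat -> nat + nat) (m : mon) u : involutive g ->
  (\big[mmul/mone]_(v <- finsupp m) expcmn (ucm (g v)) (m v)) u = m (g u).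
Proof.
move=> gK; rewrite cm_prod.
under eq_bigr => v _ do rewrite cm_exp cmU (can2_eq gK gK).
case: (boolP (g u \in finsupp m)) => h; last first.
  rewrite big_seq big1 => [|v hv]; first by apply/esym/eqP; rewrite cmE_eq0.
  by case: eqP => [e|]; [rewrite -e hv in h | rewrite muln0].
rewrite (big_rem (g u)) //= eqxx muln1 big_seq big1 ?addn0 // => v.
by rewrite mem_rem_uniq ?fset_uniq // inE => /andP[/negbTE -> _]; rewrite muln0.
Qed.

Lemma monE (m : mon) :
  m = \big[mmul/mone]_(v <- finsupp m) expcmn (ucm v) (m v).
Proof. by apply/eqP/cmP => u; rewrite (@cm_subst id). Qed.

Lemma s_monE i m u : s_mon i m u = m (s_var i u).
Proof. exact/cm_subst/s_varK. Qed.

Lemma s_monM i m1 m2 : s_mon i (mmul m1 m2) = mmul (s_mon i m1) (s_mon i m2).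
Proof. by apply/eqP/cmP => u; rewrite !(s_monE, cmM). Qed.

Lemma s_mon1 i : s_mon i mone = mone.
Proof. by apply/eqP/cmP => u; rewrite !(s_monE, cm1). Qed.

Lemma s_monU i v : s_mon i (ucm v) = ucm (s_var i v).
Proof.
by apply/eqP/cmP => u; rewrite s_monE !cmU (can2_eq (s_varK i) (s_varK i)).
Qed.

Lemma s_polD i f g : s_pol i (f + g) = s_pol i f + s_pol i g.
Proof. exact: mmapD. Qed.

Lemma s_polU i c m : s_pol i << c *g m >> = << c *g s_mon i m >>.
Proof.
by rewrite /s_pol mmapU malgM_def fgmulUU mulr1 mul1m.
Qed.

Lemma mulCU c (m : mon) : c%:MP * << m >> = << c *g m >> :> pol.
Proof. by rewrite malgM_def fgmulUU mulr1 mul1m. Qed.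

Lemma mulUU (m1 m2 : mon) : << m1 >> * << m2 >> = << mmul m1 m2 >> :> pol.
Proof. by rewrite malgM_def fgmulUU mulr1. Qed.

Lemma dvd_mulB (R : comNzRingType) (d q1 q2 a a' b b' : R) :
  d * q1 = a - a' -> d * q2 = b - b' ->
  d * (q1 * b + a' * q2) = a * b - a' * b'.
Proof.
by move=> e1 e2; rewrite mulrDr mulrA e1 mulrCA e2 mulrBl mulrBr addrA subrK.
Qed.

Lemma xvarB_dvd i f :
  exists q, (xvar i - xvar i.+1) * q = f - s_pol i f.
Proof.
rewrite [f]monalgE; elim/big_ind: _ => [|f1 f2 [q1 e1] [q2 e2]|m _].
- by exists 0; rewrite mulr0 /s_pol mmap0 subr0.
- by exists (q1 + q2); rewrite mulrDr e1 e2 s_polD addrACA opprD.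
move: (f@_m) => c {f}; rewrite s_polU.
suff [q e] : exists q : pol,
    (xvar i - xvar i.+1) * q = << m >> - << s_mon i m >>.
  exists (c%:MP * q); rewrite mulrCA e mulrBr.
  by rewrite -(mulCU c m) -(mulCU c (s_mon i m)).
have M1 : exists q : pol,
    (xvar i - xvar i.+1) * q = << (mone : mon) >> - << s_mon i mone >>.
  by exists 0; rewrite mulr0 s_mon1 subrr.
have MM (m1 m2 : mon) :
  (exists q : pol, (xvar i - xvar i.+1) * q = << m1 >> - << s_mon i m1 >>) ->
  (exists q : pol, (xvar i - xvar i.+1) * q = << m2 >> - << s_mon i m2 >>) ->
  exists q : pol, (xvar i - xvar i.+1) * q =
    << mmul m1 m2 >> - << s_mon i (mmul m1 m2) >>.
  case=> q1 e1 [q2 e2]; exists (q1 * << m2 >> + << s_mon i m1 >> * q2).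
  rewrite s_monM -(mulUU m1 m2) -(mulUU (s_mon i m1) (s_mon i m2)).
  exact: (dvd_mulB e1 e2).
have Mv v : exists q : pol, (xvar i - xvar i.+1) * q =
    << (ucm v : mon) >> - << s_mon i (ucm v) >>.
  rewrite s_monU; case: v => [j|l] /=; last by exists 0; rewrite mulr0 subrr.
  rewrite /s_; case: eqP => [->|_]; first by exists 1; rewrite mulr1.
  case: eqP => [->|_]; first by exists (-1); rewrite mulrN1 opprB.
  by exists 0; rewrite mulr0 subrr.
rewrite [m]monE; elim/big_ind: _ => [|m1 m2|v _].
- exact: M1.
- exact: MM.
elim: (m v) => [|n IH]; first exact: M1.
have -> : expcmn (ucm v) n.+1 = mmul (ucm v) (expcmn (ucm v) n) :> mon.
  by apply/eqP/cmP => u; rewrite cmM !cm_exp mulSn.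
exact: MM (Mv v) IH.
Qed.

Lemma sum_one (K : eqType) (V : zmodType) (r : seq K) (m : K) (F : K -> V) :
  uniq r -> m \in r -> (forall k, k != m -> F k = 0) -> \sum_(k <- r) F k = F m.
Proof.
move=> ur hm h; rewrite (big_rem m hm) /= big_seq big1 ?addr0 // => k.
by rewrite mem_rem_uniq // inE => /andP[/h].
Qed.

Lemma xvarM_coef j (f : pol) k : (xvar j * f)@_k =
  \sum_(m <- msupp f) f@_m *+ (mmul (ucm (inl j)) m == k).
Proof.
rewrite /xvar malgM_def fgmulUg raddf_sum /=.
by under eq_bigr => m _ do rewrite mul1r mcoeffU.
Qed.

Lemma cm_mulI (u : mon) : injective (mmul u).
Proof.
move=> m k e; apply/eqP/cmP => v.
by have := congr1 (fun f : mon => f v) e; rewrite !cmM; exact: addnI.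
Qed.

Lemma xvarM_coef_mul j (f : pol) m : m \in msupp f ->
  (xvar j * f)@_(mmul (ucm (inl j)) m) = f@_m.
Proof.
move=> hm; apply: etrans (xvarM_coef _ _ _) _.
apply: etrans (sum_one (fset_uniq _) hm _) _; last by rewrite eqxx mulr1n.
by move=> k nk; rewrite (inj_eq (@cm_mulI _)) (negbTE nk).
Qed.

Lemma xvarM_coef_neq0 j (f : pol) k : (xvar j * f)@_k != 0 ->
  exists2 m, m \in msupp f & mmul (ucm (inl j)) m = k.
Proof.
have [/hasP[m hm /eqP em] _|no] := boolP (has
  (fun m : mon => mmul (ucm (inl j)) m == k) (msupp f)); first by exists m.
case/eqP; apply: etrans (xvarM_coef _ _ _) _; apply: big1_seq => m /andP[_ hm].
by rewrite (negbTE (hasPn no _ hm)).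
Qed.

Lemma xvarB_reg i (q : pol) : (xvar i - xvar i.+1) * q = 0 -> q = 0.
Proof.
rewrite mulrBl => /subr0_eq e.
apply/eqP; apply: contraT; rewrite -msupp_eq0 => /fset0Pn[m0 hm0].
have up (m : mon) : m \in msupp q ->
    exists2 m' : mon, m' \in msupp q & m' (inl i) = (m (inl i)).+1.
  move=> hm; have nz : (xvar i.+1 * q)@_(mmul (ucm (inl i)) m) != 0.
    by rewrite -e (xvarM_coef_mul i hm) mcoeff_neq0.
  have [k hk ek] := xvarM_coef_neq0 nz; exists k => {e nz}; first exact: hk.
  have := congr1 (fun z : mon => z (inl i)) ek; rewrite !cmM !cmU eqxx.
  by have -> : (inl i.+1 == inl i :> nat + nat) = false by apply/eqP; case; lia.
have {e}up n : exists2 m' : mon, m' \in msupp q & (n <= m' (inl i))%N.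
  elim: n => [|n [m hm le]]; first exact: (ex_intro2 _ _ m0 hm0).
  have [m' hm' em'] := up _ hm; exists m'; first exact: hm'.
  by rewrite em' ltnS.
have [m hm] := up (\sum_(m <- msupp q) m (inl i)).+1%N.
by rewrite (big_rem m hm) /= ltnNge leq_addr.
Qed.

Lemma pi_E i f :
  (xvar i - xvar i.+1) * pi_ i f = xvar i * f - xvar i.+1 * s_pol i f.
Proof.
have [q e] := xvarB_dvd i f.
have ring_eq (R : comNzRingType) (a b g h r : R) : (a - b) * r = g - h ->
    (a - b) * (g + b * r) = a * g - b * h.
  by move=> er; rewrite mulrDr mulrCA er; ring.
pose D : set pol :=
  [set q : pol | (xvar i - xvar i.+1) * q = xvar i * f - xvar i.+1 * s_pol i f]%classic.
exact: (@xgetPex _ 0 D (ex_intro D _ (ring_eq _ _ _ _ _ _ e))).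
Qed.

(* Main.v *)
(* Modulo products of three T's, P_w = 1 - sum_(k <= l, eta) m_eta x^eta T_k T_l
   and N_(w,i) = 1 - sum x^(s_i a) T_l + sum x^(s_i a + s_i b) T_l T_k, the last
   sum being over unordered pairs of distinct (l, a), (k, b) with a in A_(l,i)
   and b in A_(k,i).  Such a contains i but not i + 1, so pi_i kills x^(s_i a)
   and maps x^(s_i a + s_i b) to - x^(a + s_i b); hence the quadratic part of
   P_(s_i w) is pi_i of the one of P_w, plus terms x^(a + s_i b) T_l T_k.  The
   latter are in B_(k,l)(s_i w), as a + s_i b = s_i a + b.  For eta = a + b in
   B_(k,l)(w), the exponents of x_i and x_(i+1) in eta differ by at most 2, so
   that pi_i x^eta only involves x^eta, x^(s_i eta) and, if they differ by 2,
   x^(s_i a + b); all three stay in B_(k,l)(s_i w), since A_l(w) and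
   s_i A_l(w) are contained in A_l(s_i w). *)
From HB Require Import structures.
Require Import Defs.
From mathcomp Require Import all_boot all_order all_algebra.
From mathcomp Require Import finmap multiset monalg zify ring.
From mathcomp Require Import boolp classical_sets functions cardinality fsbigop.

Set Implicit Arguments.
Unset Strict Implicit.
Unset Printing Implicit Defensive.

Import GRing.Theory.

(** * Counting form of the entrywise order and of [A_] *)

(** Induction on the heads [x] and [y]. In the converse direction, a threshold [t <= y] is passed by
    every entry of [b], so the bound on the tails is trivial; if [t > y >= x], neither head is
    counted and the hypothesis restricts to the tails. *)
Lemma sorted_leq_countP (a b : seq nat) :
  sorted leq a -> sorted leq b -> size a = size b ->
  (forall j, j < size a -> nth 0 a j <= nth 0 b j) <->
  (forall t, count (leq t) a <= count (leq t) b).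
Proof.
elim: a b => [|x a IH] [|y b] //= pa pb [eqs].
have /allP xa := order_path_min leq_trans pa.
have /allP yb := order_path_min leq_trans pb.
have {IH}IH := IH b (path_sorted pa) (path_sorted pb) eqs.
split=> h.
  move=> t; apply: leq_add; last by apply: (IH.1 _ t) => j hj; apply: (h j.+1).
  by have := h 0 isT => /=; case: (leqP t x) => // tx xy; rewrite (leq_trans tx xy).
have full c t : (forall z, z \in c -> t <= z) -> count (leq t) c = size c.
  by move=> hc; apply/eqP; rewrite -all_count; apply/allP.
have xy : x <= y.
  have := h x; rewrite leqnn (full a x xa) eqs.
  by have := count_size (leq x) b; case: (x <= y) => //; lia.
case=> [//|j]; rewrite ltnS; apply: IH.2 => t.
have := h t; case: (leqP t y) => [ty _|ty].
  by rewrite (full b t) ?count_size -?eqs ?count_size // => z /yb; apply: leq_trans.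
by have -> : (t <= x) = false by lia.
Qed.

Definition vals (w : nat -> nat) (l : nat) : seq nat := [seq w j | j <- iota 1 l].

Lemma size_wsort w l : size (wsort w l) = l.
Proof. by rewrite size_sort size_map size_iota. Qed.

Lemma count_wsort P w l : count P (wsort w l) = count P (vals w l).
Proof.
have : perm_eq (wsort w l) (vals w l) by rewrite perm_sort.
by move/seq.permP/(_ P).
Qed.

(** Counts ignore order, so the sorting in [wsort] and [s_act] disappears, and applying [s_ i]
    affects only the count at the threshold [i.+1]. *)
Lemma A_P l w a : A_ l w a <->
  [/\ size a = l, sorted ltn a, all (leq 1) a &
      forall t, count (leq t) a <= count (leq t) (vals w l)].
Proof.
have E : size a = l -> sorted ltn a ->
  (forall j, j < l -> nth 0 a j <= nth 0 (wsort w l) j) <->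
  (forall t, count (leq t) a <= count (leq t) (vals w l)).
  move=> <- /(sub_sorted ltnW) sa.
  have sw : sorted leq (wsort w (size a)) by apply/sort_sorted/leq_total.
  have := sorted_leq_countP sa sw; rewrite size_wsort => /(_ erefl) ->.
  by split=> h t; have := h t; rewrite count_wsort.
by split=> -[h1 h2 h3 h4]; split=> //; apply/E.
Qed.

Lemma s_inj i : injective (s_ i).
Proof. exact: can_inj (@s_K i). Qed.

Lemma count_s_act P i a : count P (s_act i a) = count (P \o s_ i) a.
Proof.
have : perm_eq (s_act i a) (map (s_ i) a) by rewrite perm_sort.
by move/seq.permP/(_ P) ->; rewrite count_map.
Qed.

Lemma sorted_s_act i a : sorted ltn a -> sorted ltn (s_act i a).
Proof.
rewrite !ltn_sorted_uniq_leq => /andP[ua _].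
by rewrite sort_uniq (map_inj_uniq (@s_inj i)) ua sort_sorted //; apply: leq_total.
Qed.

Lemma s_act_inj i a b : sorted ltn a -> sorted ltn b ->
  s_act i a = s_act i b -> a = b.
Proof.
move=> sa sb e.
apply: (irr_sorted_eq ltn_trans ltnn sa sb) => x.
have := congr1 (fun c => s_ i x \in c) e.
by rewrite !mem_sort !(mem_map (@s_inj i)).
Qed.

(** Only the threshold [i.+1] separates [i] from [i.+1]. *)
Lemma leq_s_ i t j : t != i.+1 -> (t <= s_ i j) = (t <= j).
Proof. by rewrite /s_; case: (eqVneq j i); case: (eqVneq j i.+1); lia. Qed.

Lemma count_geq_s_ i t a : t != i.+1 ->
  count (leq t \o s_ i) a = count (leq t) a.
Proof. by move=> h; apply: eq_count => j /=; apply: leq_s_. Qed.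

Lemma count_geS t a : count (leq t) a = count_mem t a + count (leq t.+1) a.
Proof. by elim: a => //= x a ->; lia. Qed.

Lemma count_geS_s_ i a :
  count (leq i.+1 \o s_ i) a = count_mem i a + count (leq i.+2) a.
Proof.
elim: a => //= x a ->; rewrite /s_.
by case: (eqVneq x i); case: (eqVneq x i.+1); lia.
Qed.

(** * From [A_ l w] to [A_ l (s_ i \o w)] at an ascent *)

Section Ascent.

Variables (w : nat -> nat) (i : nat).
Hypothesis i_gt0 : 0 < i.
Hypothesis w_inj : injective w.
(* By injectivity, that is [w^-1 i < w^-1 (i + 1)]. *)
Hypothesis ascent : forall l, count_mem i.+1 (vals w l) <= count_mem i (vals w l).

Lemma vals_s l : vals (s_ i \o w) l = map (s_ i) (vals w l).
Proof. by rewrite /vals -map_comp. Qed.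

Lemma all_s_act a : all (leq 1) a -> all (leq 1) (s_act i a).
Proof.
move=> /allP h; rewrite all_sort; apply/allP => _ /mapP[x /h x_gt0 ->].
by rewrite leq_s_ //; lia.
Qed.

Lemma A_s l a : A_ l w a -> A_ l (s_ i \o w) a.
Proof.
move=> /A_P[h1 h2 h3 h4]; apply/A_P; split=> // t.
rewrite vals_s count_map; case: (eqVneq t i.+1) => [->|ne].
  (* At an ascent, exchanging [i] and [i.+1] among the values cannot lower the number of those that
     are at least [i.+1]. *)
  have := h4 i.+1; have := ascent l; rewrite count_geS_s_ !(count_geS i.+1); lia.
by rewrite count_geq_s_.
Qed.

Lemma A_s_act l a : A_ l w a -> A_ l (s_ i \o w) (s_act i a).
Proof.
move=> /A_P[h1 h2 h3 h4]; apply/A_P; split.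
- by rewrite size_sort size_map.
- exact: sorted_s_act.
- exact: all_s_act.
move=> t; rewrite vals_s count_map count_s_act; case: (eqVneq t i.+1) => [->|ne].
  (* If [i] is not in [a] or is a value, the bound at [i.+2] suffices. Otherwise neither [i] nor
     [i.+1] is a value, by the ascent, and the bound at [i] applies. *)
  have := h4 i; have := h4 i.+1; have := h4 i.+2; have := ascent l.
  have ua : uniq a by move: h2; rewrite ltn_sorted_uniq_leq => /andP[].
  have uw : uniq (vals w l) by rewrite (map_inj_uniq w_inj) iota_uniq.
  rewrite !count_geS_s_ !(count_geS i) !(count_geS i.+1).
  by rewrite !count_uniq_mem //; do 4 case: (_ \in _); lia.
by rewrite !count_geq_s_.
Qed.

(** If [i.+1] occurred in [a] at least as often as [i], applying [s_ i] would not increase any of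
    the counts in [A_P], so [s_act i a] would stay in [A_ l w]. *)
Lemma Ai_mem l a : Ai_ l i w a -> count_mem i a = 1 /\ count_mem i.+1 a = 0.
Proof.
case=> Aa nA; have [h1 h2 h3 h4] := (A_P _ _ _).1 Aa.
have ua : uniq a by move: h2; rewrite ltn_sorted_uniq_leq => /andP[].
have [ia|] := boolP (count_mem i.+1 a < count_mem i a).
  by move: ia; rewrite !count_uniq_mem //; do 2 case: (_ \in _).
rewrite -leqNgt => le; case: nA; apply/A_P; split.
- by rewrite size_sort size_map.
- exact: sorted_s_act.
- exact: all_s_act.
move=> t; apply: leq_trans (h4 t).
rewrite count_s_act; case: (eqVneq t i.+1) => [->|ne]; last by rewrite count_geq_s_.
by rewrite count_geS_s_ (count_geS i.+1) leq_add2r.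
Qed.

End Ascent.

(** * The group of permutations, and ascents from lengths *)

Lemma Sinf_id : Sinf id.
Proof.
split=> //; first by exists id.
by apply: (sub_finite_set _ (@finite_set0 nat)) => j /=; case.
Qed.

Lemma Sinf_s w i : 0 < i -> Sinf w -> Sinf (s_ i \o w).
Proof.
move=> i0 [bw w0 fw]; split=> /=.
- by apply: bij_comp bw; exists (s_ i); apply: s_K.
- by rewrite w0 /s_; case: i i0.
apply: (@sub_finite_set _ _ ([set j | w j <> j] `|` [set i; i.+1])%classic).
  move=> j /=; case: (pselect (w j = j)) => [->|]; last by left.
  rewrite /s_; case: (eqVneq j i) => [->|_]; first by right; left.
  by case: (eqVneq j i.+1) => [->|//]; right; right.
by rewrite finite_setU.
Qed.

Lemma Sinf_bound w : Sinf w -> exists n, forall j, n < j -> w j = j.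
Proof.
(* The sum of the moved points bounds each of them. *)
move=> [_ _ fw]; exists (\sum_(j <- fset_set [set j | w j <> j]%classic) j).
move=> j lj; apply: contrapT => h.
have hj : j \in fset_set [set j | w j <> j]%classic by rewrite in_fset_set // inE.
by move: lj; rewrite (big_rem j hj) /=; lia.
Qed.

Definition invs (w : nat -> nat) : set (nat * nat) :=
  [set p : nat * nat | (p.1 < p.2)%N /\ (w p.2 < w p.1)%N]%classic.

Lemma finite_invs w : Sinf w -> finite_set (invs w).
Proof.
move=> Sw; have [n hn] := Sinf_bound Sw; have [/bij_inj w_inj _ _] := Sw.
apply: (@sub_finite_set _ _ (`I_n.+1 `*` `I_n.+1)%classic); last first.
  exact/finite_setX/finite_II/finite_II.
case=> a b [/= ab wab].
have bn : b <= n.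
  rewrite leqNgt; apply/negP => nb; move: wab; rewrite (hn b nb) => bwa.
  have e : w a = a by apply: w_inj; apply: hn; lia.
  by lia.
by split=> /=; lia.
Qed.

(** If [i.+1] were among the first [l] values but [i] were not, [i.+1] would occur before [i] in
    [w]. Then every inversion of [s_ i \o w] would be one of [w], against the length hypothesis. *)
Lemma ascentP w i : Sinf w -> 0 < i -> len w < len (s_ i \o w) ->
  forall l, count_mem i.+1 (vals w l) <= count_mem i (vals w l).
Proof.
move=> Sw i0 lt l; have [bw w0 _] := Sw; have w_inj := bij_inj bw.
have uw : uniq (vals w l) by rewrite (map_inj_uniq w_inj) iota_uniq.
rewrite !count_uniq_mem //.
case: (boolP (i.+1 \in _)) => // /mapP[b hb eb].
case: (boolP (i \in _)) => // ni; exfalso.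
have [v vK wK] := bw; have ea : w (v i) = i by rewrite wK.
have lva : b < v i.
  rewrite ltnNge; apply/negP => le; move/negP: ni; apply; apply/mapP.
  exists (v i); last by rewrite ea.
  move: hb; rewrite !mem_iota => /andP[b1 b2].
  apply/andP; split; last by lia.
  (* Positions start at 1; [v i] is not 0 because [w] fixes 0 and [i] is positive. *)
  by rewrite lt0n; apply/eqP => e; move: ea; rewrite e w0; lia.
move: lt; rewrite /len ltnNge => /negP; apply.
apply: fsubset_leq_card.
have sub : (invs (s_ i \o w) `<=` invs w)%classic.
  case=> p q [/= pq wpq]; split=> //=; move: wpq; rewrite /s_.
  case: (eqVneq (w q) i.+1) => [eq|_]; last by repeat case: eqP; lia.
  case: (eqVneq (w p) i) => [ep _|]; last by repeat case: eqP; lia.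
  have ebq : b = q by apply: w_inj; rewrite -eb eq.
  have evp : v i = p by apply: w_inj; rewrite ea ep.
  by lia.
by rewrite -fset_set_sub //; apply: finite_invs => //; apply: Sinf_s.
Qed.

Local Open Scope ring_scope.

(** * Polynomials with prescribed support *)

Definition supp_in (S : set mon) (f : pol) : Prop :=
  forall m, f@_m != 0 -> S m.

Lemma supp_in0 S : supp_in S 0.
Proof. by move=> m; rewrite mcoeff0 eqxx. Qed.

Lemma supp_inD S f g : supp_in S f -> supp_in S g -> supp_in S (f + g).
Proof.
move=> hf hg m; rewrite mcoeffD => nz.
case: (eqVneq f@_m 0) => [f0|]; last exact: hf.
by apply: hg; rewrite f0 add0r in nz.
Qed.

Lemma supp_inN S f : supp_in S f -> supp_in S (- f).
Proof. by move=> hf m; rewrite mcoeffN oppr_eq0; apply: hf. Qed.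

Lemma supp_inB S f g : supp_in S f -> supp_in S g -> supp_in S (f - g).
Proof. by move=> hf hg; apply: supp_inD => //; apply: supp_inN. Qed.

Lemma supp_inU (S : set mon) m : S m -> supp_in S << m >>.
Proof.
by move=> h m'; rewrite mcoeffU; case: (eqVneq m m') => [<-|]; rewrite ?eqxx.
Qed.

Lemma supp_in_sum S (I : eqType) (r : seq I) (F : I -> pol) :
  (forall j, j \in r -> supp_in S (F j)) -> supp_in S (\sum_(j <- r) F j).
Proof.
move=> h; rewrite big_seq; elim/big_ind: _ => //; first exact: supp_in0.
exact: supp_inD.
Qed.

Lemma supp_inS (S S' : set mon) f : (S `<=` S')%classic -> supp_in S f -> supp_in S' f.
Proof. by move=> h hf m /hf/h. Qed.

Lemma malgUz (c : int) (m : mon) : << c *g m >> = << m >> *~ c :> pol.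
Proof.
rewrite -mulCU -mulrzl -[in LHS](intz c).
by rewrite (rmorph_int (@malgC mon int)).
Qed.

(** Coefficients are integers, so an additive map commutes with them and is controlled by its values
    on monomials. *)
Lemma supp_in_additive (phi : {additive pol -> pol}) (S S' : set mon) f :
  supp_in S f -> (forall m, S m -> supp_in S' (phi << m >>)) ->
  supp_in S' (phi f).
Proof.
move=> hf h; rewrite [f]monalgE raddf_sum; apply: supp_in_sum => m.
rewrite -mcoeff_neq0 => /hf/h hm m'; rewrite malgUz raddfMz raddfMz /= => nz.
by apply: hm; apply: contraNneq nz => ->; rewrite mul0rz.
Qed.

Lemma supp_inM (S1 S2 S : set mon) f g : supp_in S1 f -> supp_in S2 g ->
  (forall m1 m2, S1 m1 -> S2 m2 -> S (mmul m1 m2)) -> supp_in S (f * g).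
Proof.
move=> hf hg h.
apply: (@supp_in_additive (f \*o idfun) S2 S g hg) => m2 h2 /=.
apply: (@supp_in_additive (<< m2 >> \o* idfun) S1 S f hf) => m1 h1 /=.
by rewrite mulUU; apply: supp_inU; apply: h.
Qed.

(** * The operator [pi_] on monomials *)

Lemma pi_uniq i f q :
  (xvar i - xvar i.+1) * q = xvar i * f - xvar i.+1 * s_pol i f -> pi_ i f = q.
Proof.
move=> e; apply/eqP; rewrite -subr_eq0; apply/eqP/(@xvarB_reg i).
by rewrite mulrBr e pi_E subrr.
Qed.

(** This and the later [string_eq] lemmas are stated in an abstract ring, where [ring] handles
    variables instead of concrete polynomials. *)
Lemma string_eqB (R : comNzRingType) (a b p q f g f' g' : R) :
  (a - b) * p = a * f - b * f' -> (a - b) * q = a * g - b * g' ->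
  (a - b) * (p - q) = a * (f - g) - b * (f' - g').
Proof. by rewrite mulrBr => -> ->; ring. Qed.

Lemma s_polB i f g : s_pol i (f - g) = s_pol i f - s_pol i g.
Proof. exact: mmapB. Qed.

Lemma pi_is_zmod_morphism i : zmod_morphism (pi_ i).
Proof.
move=> f g; apply: pi_uniq; rewrite s_polB.
exact: (string_eqB (pi_E i f) (pi_E i g)).
Qed.

HB.instance Definition _ i :=
  GRing.isZmodMorphism.Build pol pol (pi_ i) (@pi_is_zmod_morphism i).

(* With the coercion of monomials to functions left implicit, [lia] does not
   recognize equal exponents. *)
Definition mexp (m : mon) (u : nat + nat) : nat := m u.

Lemma monP (m m' : mon) : (forall u, mexp m u = mexp m' u) -> m = m'.
Proof. by move=> h; apply/eqP/cmP. Qed.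

Lemma mexpM (m m' : mon) u : mexp (mmul m m') u = (mexp m u + mexp m' u)%N.
Proof. exact: cmM. Qed.

Lemma mexp_s i (m : mon) u : mexp (s_mon i m) u = mexp m (s_var i u).
Proof. exact: s_monE. Qed.

Lemma mexpU (v u : nat + nat) : mexp (ucm v) u = (v == u).
Proof. exact: cmU. Qed.

Lemma xvarU_eq i j (m m' : mon) :
  mmul (ucm (inl i)) m = mmul (ucm (inl j)) m' -> xvar i * << m >> = xvar j * << m' >>.
Proof.
by move=> e; apply: etrans (mulUU _ _) _; rewrite e; apply: esym (mulUU _ _).
Qed.

Lemma string_eqM (R : comNzRingType) (a b p f f' u : R) :
  (a - b) * p = a * f - b * f' ->
  (a - b) * (u * p) = a * (u * f) - b * (u * f').
Proof. by move=> e; rewrite mulrCA e; ring. Qed.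

Lemma string_eqD (R : comNzRingType) (a b p q : R) :
  a * q = b * p -> (a - b) * (p + q) = a * p - b * q.
Proof. by move=> e; rewrite mulrDr !mulrBl e; ring. Qed.

Lemma pi_U (i : nat) (m : mon) q :
  (xvar i - xvar i.+1) * q = xvar i * << m >> - xvar i.+1 * << s_mon i m >> ->
  pi_ i << m >> = q.
Proof. by rewrite -s_polU; apply: pi_uniq. Qed.

(** Invariant monomials come out of [pi_]; this is applied to products of the variables [T_l]. *)
Lemma pi_symM i (u v : mon) : s_mon i u = u ->
  pi_ i << mmul u v >> = << u >> * pi_ i << v >>.
Proof.
move=> su; apply: pi_U; rewrite s_monM su -(mulUU u v) -(mulUU u (s_mon i v)).
by apply: string_eqM; rewrite -s_polU; apply: pi_E.
Qed.

Lemma string_eq0 (R : comNzRingType) (a b p q : R) :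
  a * p = b * q -> (a - b) * 0 = a * p - b * q.
Proof. by move=> ->; rewrite mulr0 subrr. Qed.

Lemma string_eq_up2 (R : comNzRingType) (a b p q c : R) :
  a * c = b * p -> b * c = a * q -> (a - b) * (p + q + c) = a * p - b * q.
Proof. by move=> e1 e2; rewrite !mulrDr !mulrBl e1 e2; ring. Qed.

Lemma string_eq_down2 (R : comNzRingType) (a b p q c : R) :
  b * c = a * p -> a * c = b * q -> (a - b) * - c = a * p - b * q.
Proof. by move=> e1 e2; rewrite mulrN mulrBl e1 e2; ring. Qed.

Lemma mon_stringP (i : nat) (m m' : mon) : mexp m (inl i) = mexp m' (inl i) ->
  mexp m (inl i.+1) = mexp m' (inl i.+1) ->
  (forall u, u != inl i -> u != inl i.+1 -> mexp m u = mexp m' u) -> m = m'.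
Proof.
move=> h1 h2 h; apply: monP => u.
by case: (eqVneq u (inl i)) (eqVneq u (inl i.+1)) => [->//|n1] [->//|n2]; apply: h.
Qed.

Lemma s_var_l i : s_var i (inl i) = inl i.+1.
Proof. by rewrite /s_var /s_ eqxx. Qed.

Lemma s_var_r i : s_var i (inl i.+1) = inl i.
Proof. by rewrite -s_var_l s_varK. Qed.

Lemma s_var_id i u : u != inl i -> u != inl i.+1 -> s_var i u = u.
Proof.
case: u => [j n1 n2|//]; congr inl; rewrite /s_.
case: eqP => [e|_]; first by rewrite e eqxx in n1.
by case: eqP => [e|//]; rewrite e eqxx in n2.
Qed.

Lemma mexpU_string (i : nat) : (mexp (ucm (inl i)) (inl i) = 1%N) *
  (mexp (ucm (inl i)) (inl i.+1) = 0%N) *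
  (mexp (ucm (inl i.+1)) (inl i) = 0%N) *
  (mexp (ucm (inl i.+1)) (inl i.+1) = 1%N).
Proof.
rewrite !mexpU !eqxx.
have -> : (inl i == inl i.+1 :> nat + nat) = false by apply/eqP; case; lia.
by have -> : (inl i.+1 == inl i :> nat + nat) = false by apply/eqP; case; lia.
Qed.

Lemma mexpU_neq (i : nat) (u : nat + nat) : u != inl i -> mexp (ucm (inl i)) u = 0%N.
Proof. by rewrite mexpU eq_sym => /negbTE ->. Qed.

(** Compares exponents at [x_i], at [x_(i+1)] and at any other variable, where hypotheses quantified
    over variables are specialized. *)
Ltac string_lia i := apply: (@mon_stringP i);
  [ rewrite !(mexpM, mexp_s, s_var_l, s_var_r, mexpU_string); lia
  | rewrite !(mexpM, mexp_s, s_var_l, s_var_r, mexpU_string); lia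
  | let u := fresh "u" in let hl := fresh "hl" in let hr := fresh "hr" in
    intros u hl hr;
    repeat match goal with
    | h : forall u : nat + nat, _ |- _ =>
      specialize (h u); rewrite ?s_var_id ?mexpU_neq // in h end;
    rewrite !(mexpM, mexp_s) ?s_var_id ?mexpU_neq //; lia ].

Lemma pi_U_eq (i : nat) (m : mon) :
  mexp m (inl i) = mexp m (inl i.+1) -> pi_ i << m >> = << m >>.
Proof.
move=> e; apply: pi_U; have -> : s_mon i m = m by string_lia i.
exact: mulrBl.
Qed.

Lemma pi_U_up (i : nat) (m : mon) : mexp m (inl i) = (mexp m (inl i.+1)).+1 ->
  pi_ i << m >> = << m >> + << s_mon i m >>.
Proof.
move=> e; apply: pi_U; apply: string_eqD; apply: xvarU_eq; string_lia i.
Qed.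

Lemma pi_U_down (i : nat) (m : mon) : mexp m (inl i.+1) = (mexp m (inl i)).+1 ->
  pi_ i << m >> = 0.
Proof.
move=> e; apply: pi_U; apply: string_eq0; apply: xvarU_eq; string_lia i.
Qed.

Lemma mexp_half (c m : mon) i : mmul c c = mmul m (s_mon i m) ->
  forall u : nat + nat, (mexp c u + mexp c u = mexp m u + mexp m (s_var i u))%N.
Proof. by move=> e u; rewrite -mexpM e mexpM mexp_s. Qed.

(** The middle monomial [c] between [m] and [s_mon i m] is specified by its square, since its
    exponents are the averages of theirs. *)
Lemma pi_U_up2 (i : nat) (m c : mon) : mexp m (inl i) = (mexp m (inl i.+1)).+2 ->
  mmul c c = mmul m (s_mon i m) ->
  pi_ i << m >> = << m >> + << s_mon i m >> + << c >>.
Proof.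
move=> e /mexp_half h; apply: pi_U.
have := h (inl i); have := h (inl i.+1); rewrite s_var_l s_var_r => h1 h2.
by apply: string_eq_up2; apply: xvarU_eq; string_lia i.
Qed.

Lemma pi_U_down2 (i : nat) (m c : mon) : mexp m (inl i.+1) = (mexp m (inl i)).+2 ->
  mmul c c = mmul m (s_mon i m) -> pi_ i << m >> = - << c >>.
Proof.
move=> e /mexp_half h; apply: pi_U.
have := h (inl i); have := h (inl i.+1); rewrite s_var_l s_var_r => h1 h2.
by apply: string_eq_down2; apply: xvarU_eq; string_lia i.
Qed.

Local Open Scope nat_scope.

(** * Monomials quadratic in the [T_l] *)

Definition quad (l k : nat) (a b : seq nat) : mon :=
  mmul (xmon (a ++ b)) (mmul (Tmon l) (Tmon k)).

Lemma mexp_xmon_l a (j : nat) : mexp (xmon a) (inl j) = count_mem j a.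
Proof.
rewrite /mexp /xmon cm_prod -sumn_count sumnE big_map.
by apply: eq_bigr => v _; apply: mexpU.
Qed.

Lemma mexp_xmon_r a (t : nat) : mexp (xmon a) (inr t) = 0.
Proof.
rewrite /mexp /xmon cm_prod big1 // => v _.
by rewrite (_ : ucm _ _ = (inl v == inr t :> nat + nat) :> nat) //; apply: mexpU.
Qed.

Lemma mexp_Tmon_l l (j : nat) : mexp (Tmon l) (inl j) = 0.
Proof. by rewrite /Tmon mexpU. Qed.

Lemma mexp_Tmon_r l (t : nat) : mexp (Tmon l) (inr t) = (l == t).
Proof. by rewrite /Tmon mexpU. Qed.

Lemma mexp_quad_l l k a b (j : nat) :
  mexp (quad l k a b) (inl j) = count_mem j a + count_mem j b.
Proof. by rewrite !mexpM mexp_xmon_l !mexp_Tmon_l count_cat !addn0. Qed.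

Lemma mexp_quad_r l k a b (t : nat) :
  mexp (quad l k a b) (inr t) = (l == t) + (k == t).
Proof. by rewrite !mexpM mexp_xmon_r !mexp_Tmon_r. Qed.

Lemma s_left i : s_ i i = i.+1.
Proof. by rewrite /s_ eqxx. Qed.

Lemma s_right i : s_ i i.+1 = i.
Proof. by rewrite -[X in s_ i X]s_left s_K. Qed.

Lemma s_id i j : j != i -> j != i.+1 -> s_ i j = j.
Proof. by rewrite /s_ => /negbTE -> /negbTE ->. Qed.

Lemma count_mem_s_act i (j : nat) a : count_mem j (s_act i a) = count_mem (s_ i j) a.
Proof.
rewrite count_s_act; apply: eq_count => x /=.
by apply/eqP/eqP => [<-|->]; rewrite s_K.
Qed.

Lemma s_actK i a : sorted ltn a -> s_act i (s_act i a) = a.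
Proof.
move=> sa; apply: (irr_sorted_eq ltn_trans ltnn) => //.
  exact/sorted_s_act/sorted_s_act.
by move=> x; rewrite -!has_pred1 !has_count !count_mem_s_act s_K.
Qed.

Lemma quad_eqP l k a b a' b' :
  (forall j, count_mem j a + count_mem j b = count_mem j a' + count_mem j b') ->
  quad l k a b = quad l k a' b'.
Proof.
by move=> h; apply: monP => -[j|t]; rewrite ?mexp_quad_l ?mexp_quad_r.
Qed.

Lemma s_mon_quad i l k a b :
  s_mon i (quad l k a b) = quad l k (s_act i a) (s_act i b).
Proof.
apply: monP => -[j|t]; rewrite mexp_s /= ?mexp_quad_l ?mexp_quad_r //.
by rewrite !count_mem_s_act.
Qed.

Lemma string_case i (P : nat -> Prop) : P i -> P i.+1 ->
  (forall j, j != i -> j != i.+1 -> P j) -> forall j, P j.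
Proof.
move=> h1 h2 h j; case: (eqVneq j i) => [->//|n1].
by case: (eqVneq j i.+1) => [->//|n2]; apply: h.
Qed.

(** When [a] and [b] agree at [i] and [i.+1], moving only one of them by [s_ i] gives the middle
    monomial required by [pi_U_up2] and [pi_U_down2]. *)
Lemma quad_half i l k a b : count_mem i a = count_mem i b ->
  count_mem i.+1 a = count_mem i.+1 b ->
  mmul (quad l k (s_act i a) b) (quad l k (s_act i a) b) =
  mmul (quad l k a b) (s_mon i (quad l k a b)).
Proof.
move=> h1 h2; rewrite s_mon_quad; apply: monP => -[j|t]; last first.
  by rewrite mexpM [RHS]mexpM !mexp_quad_r.
rewrite mexpM [RHS]mexpM !mexp_quad_l; elim/(@string_case i): j => [||j n1 n2];
  rewrite !count_mem_s_act ?s_left ?s_right ?s_id //; lia.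
Qed.

(** The sets [B_ k l w] for all [k] and [l] together, each multi-set carried with [T_l T_k] as a
    monomial so that [pi_] can be applied. The indices are not ordered, which keeps the two factors
    symmetric. *)
Definition B_mon (w : nat -> nat) : set mon :=
  [set m | exists l k a a' b b',
    [/\ A_ l w a, A_ l w a', A_ k w b & A_ k w b'] /\
    [/\ m = quad l k a b, m = quad l k a' b' &
     [/\ a <> a', a <> b', b <> a' & b <> b']]]%classic.

Lemma A_sorted l w a : A_ l w a -> sorted ltn a.
Proof. by case. Qed.

Lemma A_count_le1 l w a j : A_ l w a -> count_mem j a <= 1.
Proof.
move=> /A_sorted; rewrite ltn_sorted_uniq_leq => /andP[/count_uniq_mem -> _].
exact: leq_b1.
Qed.

(** * Effect of one step of the recursion on quadratic monomials *)

Section Step.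

Variables (w : nat -> nat) (i : nat).
Hypothesis i_gt0 : 0 < i.
Hypothesis w_inj : injective w.
Hypothesis ascent : forall l, count_mem i.+1 (vals w l) <= count_mem i (vals w l).

Lemma B_mon_s m : B_mon w m -> B_mon (s_ i \o w) m.
Proof.
move=> [l [k [a [a' [b [b' [[h1 h2 h3 h4] h]]]]]]].
by exists l, k, a, a', b, b'; split=> //; split; apply: A_s.
Qed.

Lemma B_mon_s_mon m : B_mon w m -> B_mon (s_ i \o w) (s_mon i m).
Proof.
move=> [l [k [a [a' [b [b' [[h1 h2 h3 h4] [e e' [n1 n2 n3 n4]]]]]]]]].
have inj l1 l2 c c' : A_ l1 w c -> A_ l2 w c' -> c <> c' -> s_act i c <> s_act i c'.
  by move=> /A_sorted s1 /A_sorted s2 n /(s_act_inj s1 s2).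
exists l, k, (s_act i a), (s_act i a'), (s_act i b), (s_act i b').
split; first by split; apply: A_s_act.
split; first by rewrite e s_mon_quad.
  by rewrite e' s_mon_quad.
by split; [apply: inj h1 h2 _|apply: inj h1 h4 _|apply: inj h3 h2 _|apply: inj h3 h4 _].
Qed.

Lemma pi_B_mon m : B_mon w m -> supp_in (B_mon (s_ i \o w)) (pi_ i << m >>).
Proof.
move=> Bm; have Bsm := B_mon_s_mon Bm; have {}Bm' := B_mon_s Bm; move: Bm.
move=> [l [k [a [a' [b [b' [[h1 h2 h3 h4] [e e' [n1 n2 n3 n4]]]]]]]]].
have ec j : count_mem j a + count_mem j b = count_mem j a' + count_mem j b'.
  by rewrite -!(mexp_quad_l l k) -e -e'.
have ei := ec i; have ej := ec i.+1.
have la := A_count_le1 i h1; have la' := A_count_le1 i h2.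
have lb := A_count_le1 i h3; have lb' := A_count_le1 i h4.
have ma := A_count_le1 i.+1 h1; have ma' := A_count_le1 i.+1 h2.
have mb := A_count_le1 i.+1 h3; have mb' := A_count_le1 i.+1 h4.
have := mexp_quad_l l k a b i; have := mexp_quad_l l k a b i.+1; rewrite -e => mj mi.
(* The middle monomial: all four sets contain the same one of [i], [i.+1] and not the other. Hence
   moving [a] and [a'] keeps the two sums equal, and a moved set differs from an unmoved one at
   [i]. *)
have Bc : count_mem i a <> count_mem i.+1 a ->
    count_mem i a = count_mem i b -> count_mem i a = count_mem i a' ->
    count_mem i a = count_mem i b' ->
    count_mem i.+1 a = count_mem i.+1 b -> count_mem i.+1 a = count_mem i.+1 a' ->
    count_mem i.+1 a = count_mem i.+1 b' ->
    B_mon (s_ i \o w) (quad l k (s_act i a) b).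
  move=> ne c1 c2 c3 c4 c5 c6.
  exists l, k, (s_act i a), (s_act i a'), b, b'.
  split; first by split; do ?[exact: A_s_act | exact: A_s].
  split=> //; last split=> //.
  - apply: quad_eqP => j; rewrite !count_mem_s_act; have := ec j.
    by elim/(@string_case i): j => [||j m1 m2]; rewrite ?s_left ?s_right ?s_id //; lia.
  - by move/(s_act_inj (A_sorted h1) (A_sorted h2)).
  - by move/(congr1 (count_mem i)); rewrite count_mem_s_act s_left; lia.
  - by move/(congr1 (count_mem i)); rewrite count_mem_s_act s_left; lia.
(* Both exponents are at most 2, as the multi-set is a union of two sets. *)
have [d|[d|[d|[d|d]]]] : mexp m (inl i) = mexp m (inl i.+1) \/
    mexp m (inl i) = (mexp m (inl i.+1)).+1 \/
    mexp m (inl i.+1) = (mexp m (inl i)).+1 \/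
    mexp m (inl i) = (mexp m (inl i.+1)).+2 \/
    mexp m (inl i.+1) = (mexp m (inl i)).+2 by lia.
- by rewrite pi_U_eq //; apply: supp_inU.
- by rewrite pi_U_up //; apply: supp_inD; apply: supp_inU.
- by rewrite pi_U_down //; apply: supp_in0.
- rewrite (pi_U_up2 (c := quad l k (s_act i a) b)) //; last first.
    by rewrite e; apply: quad_half; lia.
  apply: supp_inD; last by apply: supp_inU; apply: Bc; lia.
  by apply: supp_inD; apply: supp_inU.
- rewrite (pi_U_down2 (c := quad l k (s_act i a) b)) //; last first.
    by rewrite e; apply: quad_half; lia.
  by apply: supp_inN; apply: supp_inU; apply: Bc; lia.
Qed.

Lemma pi_Ai l a : Ai_ l i w a ->
  pi_ i << mmul (xmon (s_act i a)) (Tmon l) >> = 0%R.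
Proof.
move=> /(Ai_mem i_gt0)[c1 c2]; apply: pi_U_down.
by rewrite !mexpM !mexp_Tmon_l !mexp_xmon_l !count_mem_s_act s_left s_right c1 c2.
Qed.

Lemma pi_AiM l k a b : Ai_ l i w a -> Ai_ k i w b -> (l, a) <> (k, b) ->
  supp_in (B_mon (s_ i \o w)) (pi_ i << mmul (mmul (xmon (s_act i a)) (Tmon l))
                                         (mmul (xmon (s_act i b)) (Tmon k)) >>).
Proof.
move=> Aa Ab ne; have [a1 a2] := Ai_mem i_gt0 Aa; have [b1 b2] := Ai_mem i_gt0 Ab.
have {}Aa := Aa.1; have {}Ab := Ab.1.
have -> : mmul (mmul (xmon (s_act i a)) (Tmon l)) (mmul (xmon (s_act i b)) (Tmon k)) =
    quad l k (s_act i a) (s_act i b).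
  apply: monP => -[j|t]; rewrite ?mexp_quad_l ?mexp_quad_r !mexpM.
    by rewrite !mexp_xmon_l !mexp_Tmon_l !addn0.
  by rewrite !mexp_xmon_r !mexp_Tmon_r.
rewrite (pi_U_down2 (c := quad l k a (s_act i b))); first last.
(* Writing [a] as [s_act i (s_act i a)] puts the middle monomial in the form of [quad_half] for the
   sets [s_act i a] and [s_act i b]. *)
- rewrite -{1 2}[a](s_actK i) ?(A_sorted Aa) //.
  by apply: quad_half; rewrite !count_mem_s_act ?s_left ?s_right; lia.
- by rewrite !mexp_quad_l !count_mem_s_act ?s_left ?s_right; lia.
apply: supp_inN; apply: supp_inU.
exists l, k, a, (s_act i a), (s_act i b), b.
split; first by split; do ?[exact: A_s_act | exact: A_s].
split=> //; last split.
- apply: quad_eqP => j; rewrite !count_mem_s_act.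
  by elim/(@string_case i): j => [||j m1 m2]; rewrite ?s_left ?s_right ?s_id //; lia.
- by move/(congr1 (count_mem i)); rewrite count_mem_s_act s_left; lia.
(* The index is the size of the set, so equal sets would give equal pairs. *)
- move=> eab; apply: ne; congr (_, _) => //.
  by case: Aa Ab => <- _ _ _ [<- _ _ _]; rewrite eab.
- by move/(s_act_inj (A_sorted Ab) (A_sorted Aa)) => eab; apply: ne; congr (_, _) => //;
  case: Aa Ab => <- _ _ _ [<- _ _ _]; rewrite eab.
- by move/(congr1 (count_mem i)); rewrite count_mem_s_act s_left; lia.
Qed.

End Step.

Local Open Scope ring_scope.

(** * Degree in the [T_l], and expansion of [N_] *)

Lemma mmC (u v : mon) : mmul u v = mmul v u.
Proof. by apply: monP => t; rewrite !mexpM addnC. Qed.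

Lemma mmA (u v z : mon) : mmul u (mmul v z) = mmul (mmul u v) z.
Proof. by apply: monP => t; rewrite !mexpM addnA. Qed.

Lemma mmACA (u v y z : mon) : mmul (mmul u v) (mmul y z) = mmul (mmul u y) (mmul v z).
Proof. by apply: monP => t; rewrite !mexpM addnACA. Qed.

(** The cofactor [u] is arbitrary and may itself involve some [T_l]. Thus [Tdeg1], [Tdeg2] and
    [Tdeg3] mean degree at least 1, 2 and 3, and they decrease. *)
Definition Tdeg1 : set mon := [set m | exists u l, m = mmul u (Tmon l)]%classic.

Definition Tdeg2 : set mon :=
  [set m | exists u l k, m = mmul u (mmul (Tmon l) (Tmon k))]%classic.

Definition Tdeg3 : set mon :=
  [set m | exists u l k h, m = mmul u (mmul (mmul (Tmon l) (Tmon k)) (Tmon h))]%classic.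

Lemma Tdeg21 m : Tdeg2 m -> Tdeg1 m.
Proof. by move=> [u [l [k ->]]]; exists (mmul u (Tmon l)), k; rewrite mmA. Qed.

Lemma Tdeg32 m : Tdeg3 m -> Tdeg2 m.
Proof.
move=> [u [l [k [h ->]]]]; exists (mmul u (Tmon l)), k, h.
by rewrite !mmA.
Qed.

Lemma Tdeg1M1 m1 m2 : Tdeg1 m1 -> Tdeg1 m2 -> Tdeg2 (mmul m1 m2).
Proof.
by move=> [u [l ->]] [v [k ->]]; exists (mmul u v), l, k; rewrite mmACA.
Qed.

Lemma Tdeg2M1 m1 m2 : Tdeg2 m1 -> Tdeg1 m2 -> Tdeg3 (mmul m1 m2).
Proof.
by move=> [u [l [k ->]]] [v [h ->]]; exists (mmul u v), l, k, h; rewrite mmACA.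
Qed.

Lemma pi_Tdeg3 i m : Tdeg3 m -> supp_in Tdeg3 (pi_ i << m >>).
Proof.
move=> [u [l [k [h ->]]]]; rewrite mmC pi_symM; last first.
  by rewrite !s_monM !s_monU.
apply: (@supp_inM [set mmul (mmul (Tmon l) (Tmon k)) (Tmon h)]%classic setT).
- exact: supp_inU.
- by [].
- by move=> _ m2 -> _; exists m2, l, k, h; rewrite mmC.
Qed.

Lemma prod_sub1 (T : eqType) (U : T -> mon) (r : seq T) :
  uniq r -> (forall q, Tdeg1 (U q)) ->
  exists R, \prod_(q <- r) (1 - << U q >>) = 1 - \sum_(q <- r) << U q >> + R /\
    supp_in [set m | Tdeg3 m \/ exists q q', [/\ q \in r, q' \in r, q <> q' &
      m = mmul (U q) (U q')]]%classic R.
Proof.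
move=> + TU; elim: r => [_|q r IH /andP[qr /IH[R [eR hR]]]].
  by exists 0; rewrite !big_nil subr0 addr0; split=> //; apply: supp_in0.
(* The first term adds the pairs containing [q], distinct by uniqueness of the list; the last has
   degree at least 3, since [R] has degree at least 2. *)
exists (<< U q >> * (\sum_(z <- r) << U z >>) + R - << U q >> * R); split.
  rewrite !big_cons eR.
  move: (\sum_(z <- r) _) (mkmalgU _ _) => S u.
  have E (A : comNzRingType) (u' S' R' : A) :
    (1 - u') * (1 - S' + R') = 1 - (u' + S') + (u' * S' + R' - u' * R') by ring.
  exact: E.
have sub (m : mon) : (Tdeg3 m \/ exists q1 q2, [/\ q1 \in r, q2 \in r, q1 <> q2 &
      m = mmul (U q1) (U q2)]) -> Tdeg2 m.
  case=> [/Tdeg32//|[q1 [q2 [_ _ _ ->]]]]; exact: Tdeg1M1.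
apply: supp_inB; first apply: supp_inD.
- rewrite mulr_sumr; apply: supp_in_sum => z zr.
  rewrite mulUU; apply: supp_inU; right; exists q, z; split=> //.
  + by rewrite mem_head.
  + by rewrite inE zr orbT.
  + by move=> e; rewrite e zr in qr.
- apply: supp_inS hR => m [|[q1 [q2 [h1 h2 h3 h4]]]]; [by left | right].
  by exists q1, q2; split=> //; rewrite inE ?h1 ?h2 orbT.
- apply: (@supp_inM [set U q]%classic _ _ _ _ _ hR); first exact: supp_inU.
  by move=> _ m2 -> /sub h; left; rewrite mmC; apply: Tdeg2M1.
Qed.

Lemma finite_support_sub (I : choiceType) (T : Type) (idx : T) (D : set I)
    (F : I -> T) j :
  j \in finite_support idx D F -> D j.
Proof. by case: finite_supportP => // X XD _ _ /XD. Qed.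

Definition Nmon i (q : nat * seq nat) : mon := mmul (xmon (s_act i q.2)) (Tmon q.1).

(** Each product runs over a [finite_support], a duplicate-free list inside the index set (empty by
    default), so the double product flattens to one over pairs. *)
Lemma N_prod w i : exists2 r : seq (nat * seq nat), uniq r &
  (forall q, q \in r -> Ai_ q.1 i w q.2) /\
  N_ w i = \prod_(q <- r) (1 - << Nmon i q >>).
Proof.
rewrite /N_; set s := finite_support _ _ _.
pose t l := finite_support (1 : pol) (Ai_ l i w)
  (fun a => 1 - xpow (s_act i a) * Tvar l).
exists [seq (l, a) | l <- s, a <- t l].
  apply: allpairs_uniq_dep => [|l _|[l a] [l' a'] _ _ /= [-> ->] //].
    exact: finite_support_uniq.
  exact: finite_support_uniq.
split; first by move=> q /allpairsPdep[l [a [_ h ->]]]; apply: finite_support_sub h.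
rewrite big_allpairs_dep; apply: eq_bigr => l _; apply: eq_bigr => a _.
by rewrite mulUU.
Qed.

(** * Induction along the recursion, and the theorem *)

Definition Q w : set mon := [set m | Tdeg3 m \/ B_mon w m]%classic.

Lemma Q_Tdeg2 w m : Q w m -> Tdeg2 m.
Proof.
case=> [/Tdeg32//|[l [k [a [a' [b [b' [_ [-> _ _]]]]]]]]].
by exists (xmon (a ++ b)), l, k.
Qed.

Lemma pi_1 i : pi_ i 1 = 1.
Proof.
by rewrite -[1 in LHS]/(<< mone >> : pol) pi_U_eq //; rewrite /mexp !cm1.
Qed.

Lemma isP_supp w p : isP w p -> Sinf w /\ supp_in (Q w) (p - 1).
Proof.
elim=> [|{}w i {}p i0 _ [Sw hp] lt].
  by rewrite subrr; split; [exact: Sinf_id | exact: supp_in0].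
split; first exact: Sinf_s.
have w_inj : injective w by case: Sw => /bij_inj.
have asc := ascentP Sw i0 lt.
have [r ur [rA ->]] := N_prod w i.
have [|R [-> hR]] := @prod_sub1 _ (Nmon i) r ur.
  by move=> q; exists (xmon (s_act i q.2)), q.1.
set S := \sum_(q <- r) _.
have piS : pi_ i S = 0.
  rewrite raddf_sum big_seq big1 // => q /rA; exact: pi_Ai.
have hS : supp_in Tdeg1 S.
  apply: supp_in_sum => q _; apply: supp_inU.
  by exists (xmon (s_act i q.2)), q.1.
have hSR : supp_in Tdeg1 (S - R).
  apply: supp_inB => //; apply: supp_inS hR => m [/Tdeg32/Tdeg21//|].
  move=> [q [q' [_ _ _ ->]]]; apply: Tdeg21; apply: Tdeg1M1.
    by exists (xmon (s_act i q.2)), q.1.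
  by exists (xmon (s_act i q'.2)), q'.1.
(* This isolates [1 - S], which [pi_] sends to 1. The product [(p - 1) * (S - R)] has degree at
   least 2 + 1 in the [T_l]. *)
have -> : p * (1 - S + R) = 1 - S + (R + ((p - 1) - (p - 1) * (S - R))).
  have E (A : comNzRingType) (p' S' R' : A) :
    p' * (1 - S' + R') = 1 - S' + (R' + ((p' - 1) - (p' - 1) * (S' - R'))) by ring.
  exact: E.
rewrite raddfD raddfB /= piS pi_1 subr0 [1 + _]addrC addrK.
have piQ m : Q w m -> supp_in (Q (s_ i \o w)) (pi_ i << m >>).
  case=> [/pi_Tdeg3|/pi_B_mon] h.
    by apply: supp_inS (h i) => m'; left.
  by apply: supp_inS (h _ i0 w_inj asc) => m'; right.
rewrite raddfD; apply: supp_inD.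
  apply: supp_in_additive hR _ => m /= [h|].
    by apply: (supp_inS _ (pi_Tdeg3 (i := i) h)) => m'; left.
  move=> [q [q' [/rA h /rA h' ne ->]]].
  have ne' : (q.1, q.2) <> (q'.1, q'.2) by move: ne; case: q q' {h h'} => ? ? [? ?].
  by apply: (supp_inS _ (pi_AiM i0 w_inj asc h h' ne')) => m'; right.
apply: supp_in_additive piQ; apply: supp_inB => //.
by apply: supp_inM hp hSR _ => m1 m2 /Q_Tdeg2 h1 h2; left; apply: Tdeg2M1.
Qed.

Lemma B_C w k l eta : B_ k l w eta -> B_ l k w eta.
Proof.
move=> [a [a' [b [b' [[h1 h2 h3 h4] [e e' [n1 n2 n3 n4]]]]]]].
exists b, b', a, a'; split=> //; split=> //.
  by rewrite e; apply/eq_seq_msetP; rewrite perm_catC.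
by rewrite e'; apply/eq_seq_msetP; rewrite perm_catC.
Qed.

Theorem theorem4p5 (w : nat -> nat) (p : pol) (k l : nat)
    (eta : {mset nat}%mset) :
  Sinf w -> isP w p -> (1 <= k)%N -> (k <= l)%N -> (0%N \notin eta) ->
  mcoef p k l eta <> 0%R -> B_ k l w eta.
Proof.
move=> _ /isP_supp[_ hp] _ _ _; rewrite /mcoef.
set m := mmul _ _ => nz.
have mr t : mexp m (inr t) = ((k == t) + (l == t))%N.
  by rewrite !mexpM mexp_xmon_r !mexp_Tmon_r.
have ml j : mexp m (inl j) = eta j.
  by rewrite !mexpM mexp_xmon_l !mexp_Tmon_l !addn0 count_mem_mset.
(* Since [T_k] divides [m], the constant 1 does not affect this coefficient. *)
have /hp : (p - 1)@_m != 0.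
  rewrite mcoeffB mcoeff1; have -> : (m == mone) = false.
    apply/eqP => e; have := mr k; rewrite e eqxx.
    by rewrite /mexp cm1.
  by rewrite subr0; apply/eqP => e; apply: nz; rewrite e oppr0.
case=> [[u [l1 [l2 [l3 e]]]]|].
  (* Three of the [T_l] cannot divide [m]: their indices would form a sub-multi-set of the two
     indices [k] and [l]. *)
  have /count_subseqP[s /size_subseq le /perm_size es] :
      forall t, (count_mem t [:: l1; l2; l3] <= count_mem t [:: k; l])%N.
    move=> t; rewrite /= !addn0 -mr e !mexpM !mexp_Tmon_r addnA.
    exact: leq_addl.
  by rewrite -es in le.
move=> [l' [k' [a [a' [b [b' [hA [e e' ne]]]]]]]].
have kl t : ((k == t) + (l == t) = (l' == t) + (k' == t))%N.
  by rewrite -mr e mexp_quad_r.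
have eta_cat c d : m = quad l' k' c d -> eta = seq_mset (c ++ d).
  move=> ec; apply/msetP => j.
  by rewrite mset_seqE count_cat -ml ec mexp_quad_l.
have B : B_ k' l' w eta.
  by exists a, a', b, b'; split=> //; split=> //; apply: eta_cat.
(* The exponents of the [T_l] determine the two indices only up to order; [B_C] handles the
   exchange. *)
have [[-> ->]|[-> ->]] : (k = k' /\ l = l') \/ (k = l' /\ l = k').
- have [ek|nk] := eqVneq k k'.
    left; split=> //; have := kl l; rewrite eqxx ek addnC => /addIn.
    by case: eqVneq => [->|].
  have ek : k = l'.
    have := kl k; rewrite eqxx [k' == k]eq_sym (negbTE nk) addn0.
    by case: (eqVneq l' k) => [->|].
  right; split=> //; have := kl l; rewrite eqxx ek => /addnI.
  by case: eqVneq => [->|].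
- exact: B.
- exact: B_C.
Qed.
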